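(* Let $\boldsymbol{\mathcal A},\boldsymbol{\mathcal B}$ be $^*$-algebra deformations of $^*$-algebras $\mathcal A,\mathcal B$ over $\mathsf C$ and let $\boldsymbol{\mathfrak X}$ be a $(\boldsymbol{\mathcal B}$-$\boldsymbol{\mathcal A})$-bimodule with an $\boldsymbol{\mathcal A}$-valued inner product satisfying X1, X2, X3, X5. Then the classical limit $\mathfrak X=\mathfrak C\boldsymbol{\mathfrak X}$ carries a $(\mathcal B$-$\mathcal A)$-bimodule structure and an $\mathcal A$-valued inner product satisfying X1, X2, X3, X5. Moreover: (a) if $\boldsymbol{\mathfrak X}$ satisfies X4a, then $\mathfrak X$ satisfies X4a; (b) if $\boldsymbol{\mathfrak X}$ satisfies tX6, then $\mathfrak X$ satisfies X6; (c) if $\boldsymbol{\mathfrak X}$ satisfies P1--P3, then $\mathfrak X$ satisfies P1--P3; (d) if $\boldsymbol{\mathcal A}$ is a positive deformation of $\mathcal A$ and $\boldsymbol{\mathfrak X}$ satisfies only X4 (instead of X4a), then $\mathfrak X$ satisfies X4.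
   Context: $\mathsf R$ is an ordered ring (commutative ring with $1\ne0$ and a subset $\mathsf P$ closed under sums and products such that $\mathsf R$ is the disjoint union $-\mathsf P\cup\{0\}\cup\mathsf P$), and $\mathsf C=\mathsf R(\mathrm i)$ with $\mathrm i^2=-1$ and the usual conjugation. $\mathsf R[[\lambda]]$ is an ordered ring: a non-zero $a=\sum_{r\ge r_0}\lambda^ra_r$ with $a_{r_0}\ne0$ is positive iff $a_{r_0}>0$; $\mathsf C[[\lambda]]=\mathsf R[[\lambda]](\mathrm i)$. $\mathfrak C$ applied to a formal power series is its zeroth order term. A $^*$-algebra over $\mathsf C$ is an associative (not necessarily unital) $\mathsf C$-algebra with an antilinear involution satisfying $(AB)^*=B^*A^*$. A $^*$-algebra deformation of $\mathcal A$ is $\boldsymbol{\mathcal A}=\mathcal A[[\lambda]]$ with a $\mathsf C[[\lambda]]$-bilinear associative product $\mu=\sum_r\lambda^r\mu_r$ and a $^*$-involution $I=\sum_r\lambda^rI_r$ for $\mu$ such that $\mu_0,I_0$ are the given product and involution of $\mathcal A$. A linear functional $\omega$ with values in the scalars is positive if $\omega(A^*A)\ge0$ for all $A$. The deformation is positive if every positive $\mathsf C$-linear functional $\omega_0$ of $\mathcal A$ is the zeroth order term of some positive $\mathsf C[[\lambda]]$-linear functional $\omega=\sum_r\lambda^r\omega_r$ of $\boldsymbol{\mathcal A}$. For a $^*$-algebra, $\mathcal A^{++}$ is the set of elements $\sum_ib_iB_i^*B_i$ (finite sums, $b_i$ positive scalars) and a Hermitian $A$ satisfies $A\ge0$ if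 $\omega(A)\ge0$ for all positive linear functionals $\omega$. The following axioms are used over $\mathsf C$ for $(\mathcal A,\mathcal B)$ and over $\mathsf C[[\lambda]]$ for $(\boldsymbol{\mathcal A},\boldsymbol{\mathcal B})$, for an inner product $\langle\cdot,\cdot\rangle_{\mathcal A}:\mathfrak X\times\mathfrak X\to\mathcal A$ on a bimodule: X1) linearity in the second argument; X2) $\langle x,y\rangle_{\mathcal A}=\langle y,x\rangle_{\mathcal A}^*$; X3) $\langle x,y\cdot A\rangle_{\mathcal A}=\langle x,y\rangle_{\mathcal A}A$; X4) $\langle x,x\rangle_{\mathcal A}\ge0$; X4a) $\langle x,x\rangle_{\mathcal A}\in\mathcal A^{++}$; X5) $\langle x,B\cdot y\rangle_{\mathcal A}=\langle B^*\cdot x,y\rangle_{\mathcal A}$; X6) the linear span of all $\langle x,y\rangle_{\mathcal A}$ is $\mathcal A$. tX6) (for $\boldsymbol{\mathfrak X}$) the $\mathsf C[[\lambda]]$-span of all $\langle\boldsymbol x,\boldsymbol y\rangle_{\boldsymbol{\mathcal A}}$ is dense in $\mathcal A[[\lambda]]$ in the $\lambda$-adic topology. P1) $\mathfrak X=\bigoplus_{i}\mathfrak X^{(i)}$ with $\mathfrak X^{(i)}\perp\mathfrak X^{(j)}$ for $i\ne j$. P2) The right $\mathcal A$-action preserves this direct sum. P3) Each $\mathfrak X^{(i)}$ is a union $\bigcup_\alpha\mathfrak X^{(i)}_\alpha$ of submodules indexed by a directed set, $\mathfrak X^{(i)}_\alpha\subseteq\mathfrak X^{(i)}_\beta$ for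 $\alpha\le\beta$, with $\Omega^{(i)}_\alpha\in\mathfrak X^{(i)}_\alpha$ such that every $x\in\mathfrak X^{(i)}_\alpha$ is of the form $\Omega^{(i)}_\alpha\cdot A$. Classical limit: $\boldsymbol{\mathfrak X}_L=\{\boldsymbol x\in\boldsymbol{\mathfrak X}\mid\mathfrak C\langle\boldsymbol x,\boldsymbol y\rangle_{\boldsymbol{\mathcal A}}=0\ \forall\boldsymbol y\in\boldsymbol{\mathfrak X}\}$, $\mathfrak C\boldsymbol{\mathfrak X}=\boldsymbol{\mathfrak X}/\boldsymbol{\mathfrak X}_L$ as a $\mathsf C$-module with class map $\boldsymbol x\mapsto\mathfrak C\boldsymbol x$, actions $B\cdot\mathfrak C\boldsymbol x=\mathfrak C(B\cdot\boldsymbol x)$, $\mathfrak C\boldsymbol x\cdot A=\mathfrak C(\boldsymbol x\cdot A)$ for $A\in\mathcal A$, $B\in\mathcal B$, and inner product $\langle\mathfrak C\boldsymbol x,\mathfrak C\boldsymbol y\rangle_{\mathcal A}=\mathfrak C\langle\boldsymbol x,\boldsymbol y\rangle_{\boldsymbol{\mathcal A}}$. *)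

(* Defs.v *)
Set Warnings "-notation-overridden,-ambiguous-paths,-redundant-canonical-projection".
From HB Require Import structures.
From mathcomp Require Import all_boot all_order all_algebra.
From mathcomp Require Import ring_quotient ring.
From mathcomp Require Import boolp classical_sets functions cardinality fsbigop.

Set Implicit Arguments.
Unset Strict Implicit.
Unset Printing Implicit Defensive.
Import Order.TTheory GRing.Theory Num.Theory.
Local Open Scope ring_scope.

(* An ordered ring (commutative ring with a positive cone [P] such that the
   ring is the disjoint union of [-P], [{0}] and [P]) has no zero divisors, so
   it is a [realDomainType], with [P x] written [0 < x].  The complexification
   in mathcomp-real-closed has a ring structure over fields only, which excludes
   formal power series; hence [cplx]. *)

Record cplx (S : Type) := Cplx { Re : S; Im : S }.

HB.instance Definition _ (S : Type) := gen_eqMixin (cplx S).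
HB.instance Definition _ (S : Type) := gen_choiceMixin (cplx S).

Section ComplexRing.
Variable S : comNzRingType.
Implicit Types z w : cplx S.

Definition cplx_add z w := Cplx (Re z + Re w) (Im z + Im w).
Definition cplx_opp z := Cplx (- Re z) (- Im z).
Definition cplx_mul z w :=
  Cplx (Re z * Re w - Im z * Im w) (Re z * Im w + Im z * Re w).

Lemma cplx_addA : associative cplx_add.
Proof. by move=> [a b] [c d] [e f]; rewrite /cplx_add /= !addrA. Qed.
Lemma cplx_addC : commutative cplx_add.
Proof.
by move=> [a b] [c d]; rewrite /cplx_add /= (addrC a) (addrC b).
Qed.
Lemma cplx_add0 : left_id (Cplx 0 0) cplx_add.
Proof. by move=> [a b]; rewrite /cplx_add /= !add0r. Qed.
Lemma cplx_addN : left_inverse (Cplx 0 0) cplx_opp cplx_add.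
Proof. by move=> [a b]; rewrite /cplx_add /= !addNr. Qed.

HB.instance Definition _ :=
  GRing.isZmodule.Build (cplx S) cplx_addA cplx_addC cplx_add0 cplx_addN.

Lemma cplx_mulA : associative cplx_mul.
Proof. by move=> [a b] [c d] [e f]; rewrite /cplx_mul /=; congr Cplx; ring. Qed.
Lemma cplx_mulC : commutative cplx_mul.
Proof. by move=> [a b] [c d]; rewrite /cplx_mul /=; congr Cplx; ring. Qed.
Lemma cplx_mul1 : left_id (Cplx 1 0) cplx_mul.
Proof. by move=> [a b]; rewrite /cplx_mul /= !mul1r !mul0r subr0 addr0. Qed.
Lemma cplx_mulDl : left_distributive cplx_mul cplx_add.
Proof.
by move=> [a b] [c d] [e f]; rewrite /cplx_mul /cplx_add /=; congr Cplx; ring.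
Qed.
Lemma cplx_1neq0 : Cplx 1 0 != 0 :> cplx S.
Proof. by apply/eqP => -[/eqP]; rewrite oner_eq0. Qed.

HB.instance Definition _ := GRing.Zmodule_isComNzRing.Build (cplx S)
  cplx_mulA cplx_mulC cplx_mul1 cplx_mulDl cplx_1neq0.

Definition conjz z := Cplx (Re z) (- Im z).
Definition cplx_real (a : S) : cplx S := Cplx a 0.

Lemma ReD z w : Re (z + w) = Re z + Re w. Proof. by []. Qed.
Lemma ImD z w : Im (z + w) = Im z + Im w. Proof. by []. Qed.

End ComplexRing.

Definition cplx_ge0 (S : realDomainType) (z : cplx S) : Prop :=
  Im z = 0 /\ 0 <= Re z.

(* [fps V] is the set of formal power series [V[[lambda]]]. *)
Record fps (V : Type) := Fps { coef :> nat -> V }.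

Lemma fpsP (V : Type) (a b : fps V) : (forall n, a n = b n) <-> a = b.
Proof.
split=> [|-> //]; case: a b => [a] [b] /= ab.
by congr Fps; apply/funext.
Qed.

HB.instance Definition _ (V : Type) := gen_eqMixin (fps V).
HB.instance Definition _ (V : Type) := gen_choiceMixin (fps V).

Section SeriesZmod.
Variable V : zmodType.
Implicit Types a b : fps V.

Definition fps_add a b := Fps (fun n => a n + b n).
Definition fps_opp a := Fps (fun n => - a n).
Definition fpsC (v : V) := Fps (fun n => if n == 0%N then v else 0).

Lemma fps_addA : associative fps_add.
Proof. by move=> a b c; apply/fpsP => n /=; rewrite addrA. Qed.
Lemma fps_addC : commutative fps_add.
Proof. by move=> a b; apply/fpsP => n /=; rewrite addrC. Qed.
Lemma fps_add0 : left_id (fpsC 0) fps_add.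
Proof. by move=> a; apply/fpsP => n /=; rewrite if_same add0r. Qed.
Lemma fps_addN : left_inverse (fpsC 0) fps_opp fps_add.
Proof. by move=> a; apply/fpsP => n /=; rewrite if_same addNr. Qed.

HB.instance Definition _ :=
  GRing.isZmodule.Build (fps V) fps_addA fps_addC fps_add0 fps_addN.

Lemma coef0 n : (0 : fps V) n = 0.
Proof. by rewrite /= if_same. Qed.
Lemma coefD a b n : (a + b) n = a n + b n. Proof. by []. Qed.
Lemma coefN a n : (- a) n = - a n. Proof. by []. Qed.
Lemma coefB a b n : (a - b) n = a n - b n. Proof. by []. Qed.
Lemma coef_sum (I : Type) (r : seq I) (P : pred I) (F : I -> fps V) n :
  (\sum_(i <- r | P i) F i) n = \sum_(i <- r | P i) F i n.
Proof.
by elim/big_rec2: _ => [|i x y _ <-]; rewrite ?coef0 ?coefD.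
Qed.

Lemma triangular_sum (F : nat -> nat -> nat -> V) n :
  \sum_(i < n.+1) \sum_(j < (n - i).+1) F i j (n - i - j)%N =
  \sum_(m < n.+1) \sum_(i < m.+1) F i (m - i)%N (n - m)%N.
Proof.
transitivity (\sum_(m < n.+1) \sum_(i < n.+1 | (i <= m)%N)
                F i (m - i)%N (n - m)%N); last first.
  apply: eq_bigr => m _.
  by rewrite (big_ord_widen n.+1 (fun i => F i (m - i)%N (n - m)%N)) ?ltn_ord.
rewrite (exchange_big_dep predT) //=; apply: eq_bigr => i _.
rewrite -(big_mkord predT (fun j => F i j (n - i - j)%N)).
rewrite -(big_mkord (fun m => i <= m)%N (fun m => F i (m - i)%N (n - m)%N)).
rewrite -(big_nat_widenl i 0 n.+1 predT) ?leq0n //.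
rewrite -[RHS]/(\sum_(0 + i <= m < n.+1) F i (m - i)%N (n - m)%N) big_addn.
rewrite subSn ?leq_ord //.
by apply: eq_bigr => j _; rewrite addnK subnDA subnAC.
Qed.

End SeriesZmod.

Section SeriesRing.
Variable R : comNzRingType.
Implicit Types a b : fps R.

Definition fps_mul a b := Fps (fun n => \sum_(k < n.+1) a k * b (n - k)%N).

Lemma fps_mulA : associative fps_mul.
Proof.
move=> a b c; apply/fpsP => n /=.
under eq_bigr do rewrite mulr_sumr.
under [RHS]eq_bigr do rewrite mulr_suml.
rewrite (triangular_sum (fun i j k => a i * (b j * c k))).
by apply: eq_bigr => m _; apply: eq_bigr => i _; rewrite mulrA.
Qed.
Lemma fps_mulC : commutative fps_mul.
Proof.
move=> a b; apply/fpsP => n /=; rewrite (reindex_inj rev_ord_inj) /=.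
by apply: eq_bigr => i _; rewrite subSS mulrC subKn ?leq_ord.
Qed.
Lemma fps_mul1 : left_id (fpsC 1) fps_mul.
Proof.
move=> a; apply/fpsP => n /=; rewrite big_ord_recl /= subn0 mul1r.
by rewrite big1 ?addr0 // => i _; rewrite mul0r.
Qed.
Lemma fps_mulDl : left_distributive fps_mul +%R.
Proof.
move=> a b c; apply/fpsP => n /=; rewrite -big_split /=.
by apply: eq_bigr => i _; rewrite mulrDl.
Qed.
Lemma fps_1neq0 : fpsC 1 != 0 :> fps R.
Proof. by apply/eqP => /fpsP/(_ 0%N)/eqP; rewrite /= oner_eq0. Qed.

HB.instance Definition _ := GRing.Zmodule_isComNzRing.Build (fps R)
  fps_mulA fps_mulC fps_mul1 fps_mulDl fps_1neq0.

Definition fps_unit : pred (fps R) := [pred a | `[< exists b, b * a = 1 >]].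
Definition fps_inv a : fps R :=
  if pselect (exists b, b * a = 1) is left h then projT1 (cid h) else a.

Lemma fps_mulV : {in fps_unit, left_inverse 1 fps_inv *%R}.
Proof.
move=> a /asboolP h; rewrite /fps_inv; case: pselect => // h'.
by case: (cid h').
Qed.
Lemma fps_unitP a b : b * a = 1 -> fps_unit a.
Proof. by move=> ba; apply/asboolP; exists b. Qed.
Lemma fps_inv_out : {in [predC fps_unit], fps_inv =1 id}.
Proof.
by move=> a /asboolP h; rewrite /fps_inv; case: pselect.
Qed.

HB.instance Definition _ := GRing.ComNzRing_hasMulInverse.Build (fps R)
  fps_mulV fps_unitP fps_inv_out.

End SeriesRing.

Section SeriesOrder.
Variable R : realDomainType.
Implicit Types a b : fps R.

Lemma fps_mul_lead a b r s :
  (forall k, (k < r)%N -> a k = 0) -> (forall k, (k < s)%N -> b k = 0) ->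
  (a * b) (r + s)%N = a r * b s.
Proof.
move=> ha hb; have rs : (r < (r + s).+1)%N by rewrite ltnS leq_addr.
rewrite [LHS](bigD1 (Ordinal rs)) //= addKn big1 ?addr0 // => i.
rewrite -val_eqE /= neq_ltn => /orP[ir|ri]; first by rewrite ha ?mul0r.
rewrite hb ?mulr0 // ltn_subLR ?(leq_ord i) //.
by rewrite ltn_add2r.
Qed.

Lemma fps_mul_small a b r s k :
  (forall k, (k < r)%N -> a k = 0) -> (forall k, (k < s)%N -> b k = 0) ->
  (k < r + s)%N -> (a * b) k = 0.
Proof.
move=> ha hb krs; rewrite [LHS]big1 // => i _.
have [ir|ri] := ltnP i r; first by rewrite ha ?mul0r.
rewrite hb ?mulr0 // ltn_subLR ?(leq_ord i) //.
by rewrite (leq_trans krs) // leq_add2r.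
Qed.

Lemma fps_leadP a : a != 0 ->
  exists r, (forall k, (k < r)%N -> a k = 0) /\ a r != 0.
Proof.
move=> a0; have ex : exists n, a n != 0.
  apply/not_existsP => h; case/eqP: a0; apply/fpsP => n.
  by rewrite coef0; apply/eqP; move: (h n) => /negP; rewrite negbK.
case: (ex_minnP ex) => r ar hr; exists r; split=> // k kr.
by apply/eqP/negPn/negP => /hr; rewrite leqNgt kr.
Qed.

Lemma fps_mulf_eq0 a b : a * b = 0 -> (a == 0) || (b == 0).
Proof.
move=> ab; apply/negPn/negP; rewrite negb_or => /andP[/fps_leadP[r [hr ar]]].
move=> /fps_leadP[s [hs bs]]; move/fpsP: ab => /(_ (r + s)%N).
by rewrite coef0 (fps_mul_lead hr hs) => /eqP; rewrite mulf_eq0 (negPf ar)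
  (negPf bs).
Qed.

HB.instance Definition _ :=
  GRing.ComUnitRing_isIntegral.Build (fps R) fps_mulf_eq0.

Definition fps_pos a : Prop :=
  exists r, (forall k, (k < r)%N -> a k = 0) /\ 0 < a r.
Definition fps_lt a b : bool := `[< fps_pos (b - a) >].
Definition fps_le a b : bool := (a == b) || fps_lt a b.
Definition fps_norm a : fps R := if fps_le 0 a then a else - a.

Lemma fps_lt0 a : fps_lt 0 a = `[< fps_pos a >].
Proof. by rewrite /fps_lt subr0. Qed.
Lemma fps_lt0_add a b : fps_lt 0 a -> fps_lt 0 b -> fps_lt 0 (a + b).
Proof.
rewrite !fps_lt0 => /asboolP[r [hr ar]] /asboolP[s [hs bs]]; apply/asboolP.
exists (minn r s); split=> [k|].
  by rewrite leq_min => /andP[kr ks]; rewrite coefD hr // hs // addr0.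
have [rs|sr|rs] := ltngtP r s; rewrite coefD.
- by rewrite (hs r) // addr0.
- by rewrite (hr s) // add0r.
- by rewrite -rs in bs *; rewrite addr_gt0.
Qed.
Lemma fps_lt0_mul a b : fps_lt 0 a -> fps_lt 0 b -> fps_lt 0 (a * b).
Proof.
rewrite !fps_lt0 => /asboolP[r [hr ar]] /asboolP[s [hs bs]]; apply/asboolP.
exists (r + s)%N; split=> [k|]; first exact: fps_mul_small.
by rewrite (fps_mul_lead hr hs) mulr_gt0.
Qed.
Lemma fps_lt0_ngt0 a : fps_lt 0 a -> ~~ fps_lt a 0.
Proof.
rewrite fps_lt0 => /asboolP[r [hr ar]]; apply/asboolP; rewrite sub0r.
move=> [s [hs as_]]; rewrite coefN oppr_gt0 in as_.
have [rs|sr|rs] := ltngtP r s.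
- by move: (hs r rs); rewrite coefN => /eqP; rewrite oppr_eq0 (gt_eqF ar).
- by move: as_; rewrite hr ?ltxx.
- by move: as_; rewrite -rs ltNge (ltW ar).
Qed.
Lemma fps_sub_gt0 a b : fps_lt 0 (b - a) = fps_lt a b.
Proof. by rewrite fps_lt0. Qed.
Lemma fps_lt0_total a : a != 0 -> fps_lt 0 a || fps_lt a 0.
Proof.
move=> /fps_leadP[r [hr]]; rewrite neq_lt => /orP[ar|ar]; apply/orP.
- right; apply/asboolP; exists r; rewrite sub0r; split=> [k kr|].
    by rewrite coefN hr ?oppr0.
  by rewrite coefN oppr_gt0.
- by left; rewrite fps_lt0; apply/asboolP; exists r.
Qed.
Lemma fps_normN a : fps_norm (- a) = fps_norm a.
Proof.
rewrite /fps_norm /fps_le; have [->|a0] := eqVneq a 0.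
  by rewrite !oppr0 eqxx.
rewrite !(eq_sym 0) oppr_eq0 (negPf a0) /=.
have -> : fps_lt 0 (- a) = fps_lt a 0 by rewrite /fps_lt subr0 sub0r.
case: (boolP (fps_lt a 0)) => [an|an].
  by case: ifP => // /fps_lt0_ngt0; rewrite an.
by move: (fps_lt0_total a0); rewrite (negPf an) orbF => ->; rewrite opprK.
Qed.
Lemma fps_ge0_norm a : fps_le 0 a -> fps_norm a = a.
Proof. by rewrite /fps_norm => ->. Qed.
Lemma fps_le_def a b : fps_le a b = (a == b) || fps_lt a b.
Proof. by []. Qed.

HB.instance Definition _ := Num.IntegralDomain_isLtReal.Build (fps R)
  fps_lt0_add fps_lt0_mul fps_lt0_ngt0 fps_sub_gt0 fps_lt0_total
  fps_normN fps_ge0_norm fps_le_def.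

Lemma fps_gt0P a :
  0 < a <-> exists r, (forall k, (k < r)%N -> a k = 0) /\ 0 < a r.
Proof.
by rewrite -[0 < a]/(fps_lt 0 a) fps_lt0; split=> [/asboolP|h]; last apply/asboolP.
Qed.

End SeriesOrder.

(* [C[[lambda]]] is [cplx (fps R)]; [zcoef] and [zseries] are the two directions
   of the identification with [fps (cplx R)]. *)
Section ComplexSeries.
Variable R : comNzRingType.
Implicit Types z w : cplx (fps R).

Definition zcoef z n : cplx R := Cplx (Re z n) (Im z n).
Definition zseries (c : nat -> cplx R) : cplx (fps R) :=
  Cplx (Fps (fun n => Re (c n))) (Fps (fun n => Im (c n))).
Definition zconst (c : cplx R) : cplx (fps R) :=
  Cplx (fpsC (Re c)) (fpsC (Im c)).
Definition lambda : cplx (fps R) := Cplx (Fps (fun n => (n == 1%N)%:R)) 0.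

Lemma zcoefP z w : (forall n, zcoef z n = zcoef w n) <-> z = w.
Proof.
split=> [|-> //]; case: z w => [a b] [c d] h.
by congr Cplx; apply/fpsP => n; case: (h n).
Qed.
Lemma zseriesK c n : zcoef (zseries c) n = c n.
Proof. by rewrite /zcoef /=; case: (c n). Qed.
Lemma zcoef_const c n : zcoef (zconst c) n = if n == 0%N then c else 0.
Proof. by case: c => [a b]; rewrite /zcoef /=; case: eqP. Qed.
Lemma zcoefD z w n : zcoef (z + w) n = zcoef z n + zcoef w n.
Proof. by []. Qed.
Lemma zcoefM z w n :
  zcoef (z * w) n = \sum_(k < n.+1) zcoef z k * zcoef w (n - k)%N.
Proof.
have sumE m (F : 'I_m -> cplx R) :
    \sum_i F i = Cplx (\sum_i Re (F i)) (\sum_i Im (F i)).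
  by elim/big_rec3: _ => // i x y t _ ->.
rewrite sumE /zcoef /= !big_split /=; congr Cplx.
by rewrite sumrN.
Qed.

Lemma zconstD : {morph zconst : c d / c + d}.
Proof.
move=> c d; apply/zcoefP => n; rewrite zcoefD !zcoef_const.
by case: eqP; rewrite ?addr0.
Qed.
Lemma zconstM : {morph zconst : c d / c * d}.
Proof.
move=> c d; apply/zcoefP => n; rewrite zcoefM big_ord_recl /= subn0.
rewrite !zcoef_const /= big1 ?addr0 => [|i _]; first by case: eqP; rewrite ?mulr0.
by rewrite zcoef_const /= mul0r.
Qed.
Lemma zconst1 : zconst 1 = 1.
Proof. by rewrite /zconst /=. Qed.

End ComplexSeries.

Section SeriesModule.
Variables (R : comNzRingType) (V : lmodType (cplx R)).
Implicit Types (z w : cplx (fps R)) (a b : fps V).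

Definition fps_scale z a : fps V :=
  Fps (fun n => \sum_(k < n.+1) zcoef z k *: a (n - k)%N).

Lemma fps_scaleA z w a : fps_scale z (fps_scale w a) = fps_scale (z * w) a.
Proof.
apply/fpsP => n /=.
under eq_bigr do rewrite scaler_sumr.
under [RHS]eq_bigr do rewrite zcoefM scaler_suml.
rewrite (triangular_sum (fun i j k => zcoef z i *: (zcoef w j *: a k))).
by apply: eq_bigr => m _; apply: eq_bigr => i _; rewrite scalerA.
Qed.
Lemma fps_scale1 : left_id 1 fps_scale.
Proof.
move=> a; apply/fpsP => n /=; rewrite -zconst1 big_ord_recl /= subn0.
rewrite zcoef_const scale1r big1 ?addr0 // => i _.
by rewrite zcoef_const /= scale0r.
Qed.
Lemma fps_scaleDr : right_distributive fps_scale +%R.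
Proof.
move=> z a b; apply/fpsP => n /=; rewrite -big_split /=.
by apply: eq_bigr => i _; rewrite scalerDr.
Qed.
Lemma fps_scaleDl a : {morph fps_scale^~ a : z w / z + w}.
Proof.
move=> z w; apply/fpsP => n /=; rewrite -big_split /=.
by apply: eq_bigr => i _; rewrite zcoefD scalerDl.
Qed.

HB.instance Definition _ := GRing.Zmodule_isLmodule.Build (cplx (fps R)) (fps V)
  fps_scaleA fps_scale1 fps_scaleDr fps_scaleDl.

Lemma coefZ z a n : (z *: a) n = \sum_(k < n.+1) zcoef z k *: a (n - k)%N.
Proof. by []. Qed.

End SeriesModule.

Definition is_bilinear (K : nzRingType) (U V W : lmodType K) (f : U -> V -> W) :=
  (forall u, linear (f u)) /\ (forall v, linear (f^~ v)).

Definition star_axioms (S : realDomainType) (A : lmodType (cplx S))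
    (mul : A -> A -> A) (star : A -> A) : Prop :=
  [/\ is_bilinear mul,
      associative mul,
      forall z a b, star (z *: a + b) = conjz z *: star a + star b,
      involutive star
    & forall a b, star (mul a b) = mul (star b) (star a)].

(* Associative, not necessarily unital, *-algebras over [cplx S]. *)
Record starAlg (S : realDomainType) := StarAlg {
  carrier :> lmodType (cplx S);
  smul : carrier -> carrier -> carrier;
  star : carrier -> carrier;
  starP : star_axioms smul star }.

Section Positivity.
Variables (S : realDomainType) (A : starAlg S).

Definition positive_functional (w : A -> cplx S) : Prop :=
  scalar w /\ forall a, cplx_ge0 (w (smul (star a) a)).

Definition alg_pp (a : A) : Prop :=
  exists n (b : 'I_n -> S) (c : 'I_n -> A),
    (forall i, 0 < b i) /\
    a = \sum_(i < n) cplx_real (b i) *: smul (star (c i)) (c i).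

Definition alg_ge0 (a : A) : Prop :=
  star a = a /\ forall w, positive_functional w -> cplx_ge0 (w a).

End Positivity.

Section Deformation.
Variables (R : realDomainType) (A : starAlg R).

Definition series_mul (mu : nat -> A -> A -> A) (a b : fps A) : fps A :=
  Fps (fun n => \sum_(r < n.+1) \sum_(s < n.+1) \sum_(t < n.+1 | (r + s + t == n)%N)
                  mu r (a s) (b t)).

Definition series_star (I : nat -> A -> A) (a : fps A) : fps A :=
  Fps (fun n => \sum_(r < n.+1) I r (a (n - r)%N)).

Definition series_fun (w : nat -> A -> cplx R) (a : fps A) : cplx (fps R) :=
  zseries (fun n => \sum_(r < n.+1) w r (a (n - r)%N)).

Record starDeformation := StarDeformation {
  def_mul : nat -> A -> A -> A;
  def_star : nat -> A -> A;
  def_axioms : star_axioms (series_mul def_mul) (series_star def_star);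
  def_mul0 : forall a b, def_mul 0 a b = smul a b;
  def_star0 : forall a, def_star 0 a = star a }.

Definition deformed (D : starDeformation) : starAlg (fps R) :=
  StarAlg (def_axioms D).

Definition positive_deformation (D : starDeformation) : Prop :=
  forall w0 : A -> cplx R, positive_functional w0 ->
  exists w : nat -> A -> cplx R,
    positive_functional (A := deformed D) (series_fun w) /\ w 0%N = w0.

End Deformation.

Section BimoduleAxioms.
Variables (S : realDomainType) (B A : starAlg S) (X : lmodType (cplx S)).
Variables (lact : B -> X -> X) (ract : X -> A -> X) (ip : X -> X -> A).

Definition bimodule : Prop :=
  [/\ is_bilinear lact,
      is_bilinear ract,
      forall b b' x, lact (smul b b') x = lact b (lact b' x),
      forall x a a', ract x (smul a a') = ract (ract x a) a'
    & forall b x a, ract (lact b x) a = lact b (ract x a)].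

Definition axX1 : Prop := forall x, linear (ip x).
Definition axX2 : Prop := forall x y, ip x y = star (ip y x).
Definition axX3 : Prop := forall x y a, ip x (ract y a) = smul (ip x y) a.
Definition axX4 : Prop := forall x, alg_ge0 (ip x x).
Definition axX4a : Prop := forall x, alg_pp (ip x x).
Definition axX5 : Prop := forall b x y, ip x (lact b y) = ip (lact (star b) x) y.

Definition ip_span (a : A) : Prop :=
  exists n (c : 'I_n -> cplx S) (x y : 'I_n -> X),
    a = \sum_(i < n) c i *: ip (x i) (y i).
Definition axX6 : Prop := forall a, ip_span a.

Section Decomposition.
Variables (I : choiceType) (XI : I -> {pred X}).

Definition axP1 : Prop :=
  [/\ forall i, submod_closed (XI i),
      forall x, exists! f : I -> X,
        [/\ forall i, f i \in XI i,
            finite_set [set i | f i <> 0]%classic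
          & x = \sum_(i \in [set: I]%classic) f i]
    & forall i j x y, i != j -> x \in XI i -> y \in XI j -> ip x y = 0].

Definition axP2 : Prop := forall i x a, x \in XI i -> ract x a \in XI i.

Definition directed (J : Type) (le : J -> J -> Prop) : Prop :=
  [/\ inhabited J,
      forall s, le s s,
      forall s t u, le s t -> le t u -> le s u
    & forall s t, exists2 u, le s u & le t u].

(* "Submodule" is meant for the right action of [A]. *)
Definition axP3 : Prop := forall i,
  exists (J : Type) (le : J -> J -> Prop) (XJ : J -> {pred X}) (Omega : J -> X),
  [/\ directed le,
      (forall s, submod_closed (XJ s) /\
         forall x a, x \in XJ s -> ract x a \in XJ s),
      (forall s t, le s t -> {subset XJ s <= XJ t}),
      (forall x, x \in XI i <-> exists s, x \in XJ s)
    & forall s, Omega s \in XJ s /\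
        forall x, x \in XJ s -> exists a, x = ract (Omega s) a].

End Decomposition.

Definition axP1_P3 : Prop :=
  exists (I : choiceType) (XI : I -> {pred X}), [/\ axP1 XI, axP2 XI & axP3 XI].

End BimoduleAxioms.

Definition axtX6 (R : realDomainType) (A : starAlg R) (D : starDeformation A)
    (X : lmodType (cplx (fps R))) (ip : X -> X -> fps A) : Prop :=
  forall (a : fps A) (n : nat), exists s d : fps A,
    ip_span (A := deformed D) ip s /\ a - s = lambda R ^+ n *: d.

Section QuotientModule.
Variables (K : nzRingType) (V : lmodType K) (U : {pred V}).
Hypothesis U_submod : submod_closed U.

HB.instance Definition _ := GRing.isSubmodClosed.Build K V U U_submod.

Definition quot_module : Type := Quotient.quot U.
HB.instance Definition _ := GRing.Zmodule.on quot_module.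

Definition qclass (v : V) : quot_module := \pi_(Quotient.quot U)%qT v.
Definition quot_scale (a : K) (q : quot_module) : quot_module :=
  qclass (a *: repr q).

Lemma qclass_eq v w : qclass v = qclass w <-> v - w \in U.
Proof. by rewrite (Quotient.idealrBE U); split=> /eqP. Qed.
Lemma qclassK q : qclass (repr q) = q.
Proof. exact: reprK. Qed.
Lemma qclassD : {morph qclass : v w / v + w}.
Proof. exact: raddfD. Qed.
Lemma quot_scale_class a v : quot_scale a (qclass v) = qclass (a *: v).
Proof.
by apply/qclass_eq; rewrite -scalerBr rpredZ //; apply/qclass_eq/qclassK.
Qed.

Lemma quot_scaleA a b q : quot_scale a (quot_scale b q) = quot_scale (a * b) q.
Proof. by rewrite -(qclassK q) !quot_scale_class scalerA. Qed.
Lemma quot_scale1 : left_id 1 quot_scale.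
Proof. by move=> q; rewrite -(qclassK q) quot_scale_class scale1r. Qed.
Lemma quot_scaleDr : right_distributive quot_scale +%R.
Proof.
move=> a p q; rewrite -(qclassK p) -(qclassK q) -qclassD !quot_scale_class.
by rewrite scalerDr qclassD.
Qed.
Lemma quot_scaleDl q : {morph quot_scale^~ q : a b / a + b}.
Proof.
by move=> a b; rewrite -(qclassK q) !quot_scale_class scalerDl qclassD.
Qed.

HB.instance Definition _ := GRing.Zmodule_isLmodule.Build K quot_module
  quot_scaleA quot_scale1 quot_scaleDr quot_scaleDl.

End QuotientModule.

(* Restriction of scalars along [C -> C[[lambda]]]. *)
Definition restrict (R : realDomainType) (X : lmodType (cplx (fps R))) : Type :=
  X.

Section Restriction.
Variables (R : realDomainType) (X : lmodType (cplx (fps R))).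

HB.instance Definition _ := GRing.Zmodule.on (restrict X).

Definition restrict_scale (c : cplx R) (x : restrict X) : restrict X :=
  zconst c *: (x : X).

Lemma restrict_scaleA c d x :
  restrict_scale c (restrict_scale d x) = restrict_scale (c * d) x.
Proof. by rewrite /restrict_scale zconstM scalerA. Qed.
Lemma restrict_scale1 : left_id 1 restrict_scale.
Proof. by move=> x; rewrite /restrict_scale zconst1 scale1r. Qed.
Lemma restrict_scaleDr : right_distributive restrict_scale +%R.
Proof. by move=> c x y; rewrite /restrict_scale scalerDr. Qed.
Lemma restrict_scaleDl x : {morph restrict_scale^~ x : c d / c + d}.
Proof. by move=> c d; rewrite /restrict_scale zconstD scalerDl. Qed.

HB.instance Definition _ := GRing.Zmodule_isLmodule.Build (cplx R) (restrict X)
  restrict_scaleA restrict_scale1 restrict_scaleDr restrict_scaleDl.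

End Restriction.

Section ClassicalLimit.
Variables (R : realDomainType) (A : starAlg R) (D : starDeformation A).
Variables (X : lmodType (cplx (fps R))) (ip : X -> X -> fps A).

Definition XL : {pred restrict X} :=
  [pred x | `[< forall y : X, ip x y 0%N = 0 >] ].

Lemma in_XL (x : restrict X) :
  reflect (forall y : X, ip x y 0%N = 0) (x \in XL).
Proof. exact: asboolP. Qed.

Hypotheses (ip1 : axX1 (A := deformed D) ip) (ip2 : axX2 (A := deformed D) ip).

Lemma ip_antilinear (z : cplx (fps R)) (x x' y : X) :
  ip (z *: x + x') y = conjz z *: ip x y + ip x' y.
Proof.
have [_ _ anti _ _] := def_axioms D.
by rewrite ip2 ip1 (ip2 x) (ip2 x'); exact: anti.
Qed.

Lemma XL_submod : submod_closed XL.
Proof.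
have conj1 : conjz 1 = 1 :> cplx (fps R) by rewrite /conjz /= oppr0.
split=> [|c x x' /in_XL x0 /in_XL x'0]; apply/in_XL => y.
  have := ip_antilinear 1 0 0 y.
  rewrite scale1r addr0 conj1 scale1r => /eqP.
  by rewrite -[X in X == _]addr0 (inj_eq (addrI _)) => /eqP <-; rewrite coef0.
rewrite (ip_antilinear (zconst c)) coefD coefZ big_ord1 subn0 x0 x'0.
by rewrite scaler0 addr0.
Qed.

Definition climit : lmodType (cplx R) := quot_module XL_submod.
Definition climit_class (x : X) : climit := qclass XL_submod x.

End ClassicalLimit.

(* Main.v *)
(* Since [lambda] acts by zero on [X / X_L], the class of [x . a] depends only on
   the zeroth order term of [a], and likewise for the left action; hence the
   failure of [fpsC] to respect products and involutions, which is a multiple of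
   [lambda], disappears in the quotient.  The induced inner product is
   non-degenerate by construction, and this yields uniqueness of components in
   P1: a component is determined by its inner products with vectors in its own
   summand, which are those of the whole vector. *)
Require Import Defs.
From mathcomp Require Import all_boot all_order all_algebra.
From mathcomp Require Import finmap boolp classical_sets cardinality fsbigop.

Set Implicit Arguments.
Unset Strict Implicit.
Unset Printing Implicit Defensive.
Import Order.TTheory GRing.Theory Num.Theory.
Local Open Scope ring_scope.

(** Both sums are computed over the support of [f], which contains that of [phi \o f]. Finiteness
    matters: a sum with infinite support is [0] by default, although [phi \o f] may still have
    finite support. *)
Lemma fsum_morph (V W : nmodType) (phi : V -> W) (I : choiceType) (f : I -> V) :
  phi 0 = 0 -> {morph phi : x y / x + y} ->
  finite_set [set i | f i <> 0]%classic ->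
  phi (\sum_(i \in [set: I]%classic) f i) =
  \sum_(i \in [set: I]%classic) phi (f i).
Proof.
move=> phi0 phiD ffin.
have f0 i : i \notin fset_set [set i | f i <> 0]%classic -> f i = 0.
  by rewrite in_fset_set // => /negP; rewrite inE /= => /contrapT.
rewrite (fsbigTE _ _ f0) (big_morph phi phiD phi0) -fsbigTE // => i /f0 ->.
exact: phi0.
Qed.

(** * Zeroth order terms of power series *)

Lemma zcoef_lambda (R : comNzRingType) n : zcoef (lambda R) n = (n == 1%N)%:R.
Proof. by rewrite /zcoef /= if_same; case: eqP. Qed.

Section SeriesFacts.
Variables (R : realDomainType) (V : lmodType (cplx R)).

(** The shift of [a] serves as [d]. This separates the zeroth order term from a multiple of
    [lambda], whose action vanishes in the classical limit. *)
Lemma fps_split0 (a : fps V) : exists d, a = fpsC (a 0%N) + lambda R *: d.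
Proof.
exists (Fps (fun n => a n.+1)); apply/fpsP => -[|n]; rewrite Defs.coefD Defs.coefZ.
  by rewrite big_ord1 zcoef_lambda scale0r addr0.
rewrite big_ord_recl big_ord_recl big1 => [|i _].
  by rewrite !zcoef_lambda scale0r scale1r /= subSS subn0 !add0r addr0.
by rewrite zcoef_lambda scale0r.
Qed.

Lemma fpsC_linear (c : cplx R) (v v' : V) :
  fpsC (c *: v + v') = zconst c *: fpsC v + fpsC v'.
Proof.
apply/fpsP => n; rewrite Defs.coefD Defs.coefZ big_ord_recl zcoef_const subn0 /=.
rewrite big1 ?addr0 => [|i _]; last by rewrite zcoef_const scale0r.
by case: n => [|n] /=; rewrite ?scaler0 ?addr0.
Qed.

Lemma coefZ0 (z : cplx (fps R)) (a : fps V) : (z *: a) 0%N = zcoef z 0 *: a 0%N.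
Proof. by rewrite Defs.coefZ big_ord1. Qed.

End SeriesFacts.

(** The sign of a nonzero series is that of its lowest nonzero coefficient: either this is the
    zeroth one, or the zeroth one is [0]. *)
Lemma fps_ge0_coef0 (R : realDomainType) (a : fps R) : 0 <= a -> 0 <= a 0%N.
Proof.
rewrite le_eqVlt => /predU1P[<-|/fps_gt0P[r [hr ar]]]; first by rewrite Defs.coef0.
by case: r => [|r] in hr ar *; [exact: ltW | rewrite hr].
Qed.

Lemma cplx_ge0_coef0 (R : realDomainType) (z : cplx (fps R)) :
  cplx_ge0 z -> cplx_ge0 (zcoef z 0).
Proof. by case=> /= im re; split; rewrite /= ?im ?Defs.coef0 // fps_ge0_coef0. Qed.

Section DeformedFacts.
Variables (R : realDomainType) (A : starAlg R) (D : starDeformation A).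

Lemma smul_coef0 (a b : deformed D) : smul a b 0%N = smul (a 0%N) (b 0%N).
Proof. by rewrite /= !big_ord1 big_mkcond big_ord1 /= def_mul0. Qed.

Lemma star_coef0 (a : deformed D) : star a 0%N = star (a 0%N).
Proof. by rewrite /= big_ord1 def_star0. Qed.

End DeformedFacts.

Section StarFacts.
Variables (R : realDomainType) (A : starAlg R).

Lemma starK : involutive (@star R A).
Proof. by have [] := starP A. Qed.

Lemma star_linear z (a b : A) : star (z *: a + b) = conjz z *: star a + star b.
Proof. by have [_ _ ->] := starP A. Qed.

Lemma starM (a b : A) : star (smul a b) = smul (star b) (star a).
Proof. by have [_ _ _ _] := starP A; apply. Qed.

Lemma smul0l (b : A) : smul 0 b = 0.
Proof.
have [[_ lin] _ _ _ _] := starP A.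
(* Linearity with scalar [-1] at zero vectors makes the value at [0] equal to minus itself plus
   itself. *)
by have := lin b (-1) 0 0; rewrite scaler0 addr0 scaleN1r addNr.
Qed.

Lemma smul0r (b : A) : smul b 0 = 0.
Proof.
have [[lin _] _ _ _ _] := starP A.
by have := lin b (-1) 0 0; rewrite scaler0 addr0 scaleN1r addNr.
Qed.

Lemma starB (a b : A) : star (a - b) = star a - star b.
Proof.
have conjN1 : conjz (-1) = -1 :> cplx R by rewrite /conjz /= oppr0.
by rewrite (addrC a) -scaleN1r star_linear conjN1 scaleN1r addrC.
Qed.

End StarFacts.

(** * Zeroth order pairings and classes modulo [XL] *)

Section Limit.
Variables (R : realDomainType) (A B : starAlg R).
Variables (dA : starDeformation A) (dB : starDeformation B).
Variables (X : lmodType (cplx (fps R))).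
Variables (lact : fps B -> X -> X) (ract : X -> fps A -> X).
Variable ip : X -> X -> fps A.
Hypotheses (hX : bimodule (B := deformed dB) (A := deformed dA) lact ract)
    (h1 : axX1 (A := deformed dA) ip)
    (h2 : axX2 (A := deformed dA) ip)
    (h3 : axX3 (A := deformed dA) ract ip)
    (h5 : axX5 (B := deformed dB) (A := deformed dA) lact ip).

Notation CX := (climit h1 h2).
Notation cls := (climit_class h1 h2).

Lemma ip_star0 x y : ip x y 0%N = star (ip y x 0%N).
Proof. by rewrite h2 star_coef0. Qed.

Lemma ipr0 x z y y' :
  ip x (z *: y + y') 0%N = zcoef z 0 *: ip x y 0%N + ip x y' 0%N.
Proof. by rewrite h1 [LHS]Defs.coefD coefZ0. Qed.

Lemma ipBl0 x x' y : ip (x - x') y 0%N = ip x y 0%N - ip x' y 0%N.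
Proof.
rewrite ip_star0 -scaleN1r addrC ipr0 addrC.
by rewrite [zcoef (-1) 0](_ : _ = -1) ?scaleN1r ?starB -?ip_star0.
Qed.

Lemma cls_eq x x' : cls x = cls x' <-> forall y, ip x y 0%N = ip x' y 0%N.
Proof.
rewrite qclass_eq; split=> [/in_XL h y|h].
  by apply/eqP; rewrite -subr_eq0 -ipBl0 h.
by apply/in_XL => y; rewrite [LHS]ipBl0 h subrr.
Qed.

(** [XL] is a left radical by definition; Hermitian symmetry makes it the right radical as well. *)
Lemma cls_eqr x x' : cls x = cls x' <-> forall y, ip y x 0%N = ip y x' 0%N.
Proof.
rewrite cls_eq; split=> h y; first by rewrite ip_star0 h -ip_star0.
by rewrite ip_star0 h -ip_star0.
Qed.

Lemma cls_surj (q : CX) : exists x, q = cls x.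
Proof. by exists (repr q); rewrite /climit_class qclassK. Qed.

Lemma cls_linear c x y : cls (zconst c *: x + y) = c *: cls x + cls y.
Proof.
have -> : c *: cls x = cls (zconst c *: x) by exact: quot_scale_class.
exact: qclassD.
Qed.

Lemma cls_lambda x y : cls (x + lambda R *: y) = cls x.
Proof.
by apply/cls_eqr => z; rewrite addrC ipr0 zcoef_lambda scale0r add0r.
Qed.

(** The three operations are evaluated on chosen representatives; [lact0E], [ract0E] and [ip0E]
    below show that the choice does not matter. *)
Definition lact0 (b : B) (q : CX) : CX := cls (lact (fpsC b) (repr q)).
Definition ract0 (q : CX) (a : A) : CX := cls (ract (repr q) (fpsC a)).
Definition ip0 (p q : CX) : A := ip (repr p) (repr q) 0%N.

(** By X5 the action of [b] moves to the other argument as that of [star b], where the pairings of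
    [x] and [x'] agree against every vector. *)
Lemma cls_lact b x x' : cls x = cls x' -> cls (lact b x) = cls (lact b x').
Proof.
move/cls_eqr => h; apply/cls_eq => y.
have e u : ip (lact b u) y = ip u (lact (star (b : deformed dB)) y).
  by rewrite h5 starK.
by rewrite !e; move: (lact _ y); apply/cls_eq/cls_eqr.
Qed.

(** X3 takes [a] out of the inner product, and zeroth order terms are multiplicative. *)
Lemma cls_ract x x' a : cls x = cls x' -> cls (ract x a) = cls (ract x' a).
Proof. by move/cls_eqr => h; apply/cls_eqr => y; rewrite !h3 !smul_coef0 h. Qed.

Lemma cls_lact_coef0 (b : fps B) x : cls (lact b x) = cls (lact (fpsC (b 0%N)) x).
Proof.
have [[_ lin] _ _ _ _] := hX; have [d {1}->] := fps_split0 b.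
by rewrite addrC lin addrC cls_lambda.
Qed.

Lemma cls_ract_coef0 x (a : fps A) : cls (ract x a) = cls (ract x (fpsC (a 0%N))).
Proof.
have [_ [lin _] _ _ _] := hX; have [d {1}->] := fps_split0 a.
by rewrite addrC lin addrC cls_lambda.
Qed.

Lemma lact0E b x : lact0 b (cls x) = cls (lact (fpsC b) x).
Proof. by apply: cls_lact; rewrite /climit_class qclassK. Qed.

Lemma ract0E x a : ract0 (cls x) a = cls (ract x (fpsC a)).
Proof. by apply: cls_ract; rewrite /climit_class qclassK. Qed.

Lemma ip0E x y : ip0 (cls x) (cls y) = ip x y 0%N.
Proof.
have reprK (z : X) : cls (repr (cls z)) = cls z by rewrite /climit_class qclassK.
have /cls_eq hx := reprK x; have /cls_eqr hy := reprK y.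
by rewrite /ip0 hx hy.
Qed.

(** * Bimodule structure and basic axioms of the limit *)

Lemma climit_bimodule : bimodule lact0 ract0.
Proof.
have [[lr ll] [rr rl] lM rM lrA] := hX.
split; first split.
- move=> b c p q; have [x ->] := cls_surj p; have [y ->] := cls_surj q.
  by rewrite -cls_linear !lact0E lr cls_linear.
- move=> q c b b'; have [x ->] := cls_surj q.
  by rewrite !lact0E fpsC_linear ll cls_linear.
- split=> [q c a a'|a c p q].
    have [x ->] := cls_surj q.
    by rewrite !ract0E fpsC_linear rr cls_linear.
  have [x ->] := cls_surj p; have [y ->] := cls_surj q.
  by rewrite -cls_linear !ract0E rl cls_linear.
- move=> b b' q; have [x ->] := cls_surj q; rewrite !lact0E -lM.
  by rewrite [RHS]cls_lact_coef0 smul_coef0.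
- move=> q a a'; have [x ->] := cls_surj q; rewrite !ract0E -rM.
  by rewrite [RHS]cls_ract_coef0 smul_coef0.
- by move=> b q a; have [x ->] := cls_surj q; rewrite lact0E !ract0E lact0E lrA.
Qed.

Lemma climit_X1 : axX1 ip0.
Proof.
move=> p c q q'; have [x ->] := cls_surj p; have [y ->] := cls_surj q.
have [y' ->] := cls_surj q'.
by rewrite -cls_linear !ip0E ipr0 zcoef_const.
Qed.

Lemma climit_X2 : axX2 ip0.
Proof.
move=> p q; have [x ->] := cls_surj p; have [y ->] := cls_surj q.
by rewrite !ip0E ip_star0.
Qed.

Lemma climit_X3 : axX3 ract0 ip0.
Proof.
move=> p q a; have [x ->] := cls_surj p; have [y ->] := cls_surj q.
by rewrite ract0E !ip0E h3 smul_coef0.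
Qed.

Lemma climit_X5 : axX5 lact0 ip0.
Proof.
move=> b p q; have [x ->] := cls_surj p; have [y ->] := cls_surj q.
rewrite !lact0E !ip0E h5 -!ip0E.
(* The deformed adjoint of [fpsC b] need not be constant; the class retains only its zeroth order
   term [star b]. *)
by rewrite [X in ip0 X _ = _]cls_lact_coef0 star_coef0.
Qed.

(** * Positivity and fullness *)

Lemma climit_X4a : axX4a (A := deformed dA) ip -> axX4a ip0.
Proof.
move=> h4 q; have [x ->] := cls_surj q; rewrite ip0E.
have [n [b [c [b_gt0 ->]]]] := h4 x.
(* The positive scalar [b i] may have zeroth order term [0], whereas [alg_pp]
   requires positive scalars: such a summand is written [1 *: 0^* 0]. *)
exists n, (fun i => if b i 0%N == 0 then 1 else b i 0%N).
exists (fun i => if b i 0%N == 0 then 0 else c i 0%N); split=> [i|].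
  have [_|bi0] := eqVneq; first exact: ltr01.
  by rewrite lt_neqAle eq_sym bi0 fps_ge0_coef0 ?ltW.
rewrite Defs.coef_sum; apply: eq_bigr => i _; rewrite coefZ0 smul_coef0 star_coef0.
rewrite [zcoef _ 0](_ : _ = cplx_real (b i 0%N)) //; case: eqP => // ->.
by rewrite smul0r scaler0 [cplx_real 0](_ : _ = 0) ?scale0r.
Qed.

(** A positive [w0] lifts to a positive functional of the deformation. Its value on [ip x x] has
    zeroth order term [w0 (ip x x 0)], and passing to zeroth order preserves nonnegativity. *)
Lemma climit_X4 :
  positive_deformation dA -> axX4 (A := deformed dA) ip -> axX4 ip0.
Proof.
move=> dA_pos h4 q; have [x ->] := cls_surj q.
split=> [|w0 w0_pos]; first by rewrite -climit_X2.
have [w [w_pos <-]] := dA_pos _ w0_pos.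
have /cplx_ge0_coef0 := (h4 x).2 _ w_pos.
by rewrite ip0E zseriesK big_ord1.
Qed.

Lemma climit_X6 : axtX6 dA ip -> axX6 ip0.
Proof.
(* Approximating the constant series modulo [lambda] suffices: the error has no zeroth order term,
   so [a] is exactly the zeroth order term of [s]. *)
move=> h6 a; have [s [d [[n [c [x [y ->]]]]]]] := h6 (fpsC a) 1%N.
move/fpsP/(_ 0%N); rewrite expr1 Defs.coefB coefZ0 zcoef_lambda scale0r.
move/eqP; rewrite subr_eq0 => /eqP /= ->.
exists n, (fun i => zcoef (c i) 0), (fun i => cls (x i)), (fun i => cls (y i)).
by rewrite Defs.coef_sum; apply: eq_bigr => i _; rewrite coefZ0 ip0E.
Qed.

(** * Non-degeneracy and orthogonal decompositions *)

Lemma ip0Dl p p' q : ip0 (p + p') q = ip0 p q + ip0 p' q.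
Proof.
rewrite climit_X2 -(scale1r p) climit_X1 star_linear -!climit_X2.
by rewrite [conjz 1](_ : _ = 1) ?scale1r // /conjz /= oppr0.
Qed.

Lemma ip0_0l q : ip0 0 q = 0.
Proof. by apply: (addrI (ip0 0 q)); rewrite -ip0Dl !addr0. Qed.

Lemma ip0_nondegenerate p p' : (forall q, ip0 p q = ip0 p' q) -> p = p'.
Proof.
have [x ->] := cls_surj p; have [x' ->] := cls_surj p' => h.
by apply/cls_eq => y; rewrite -!ip0E.
Qed.

Lemma clsD : {morph cls : x y / x + y}.
Proof. by move=> x y; rewrite -{1}(scale1r x) -(zconst1 R) cls_linear scale1r. Qed.

Lemma cls0 : cls 0 = 0.
Proof. by apply: (addrI (cls 0)); rewrite -clsD !addr0. Qed.

Definition class_image (U : {pred X}) : {pred CX} :=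
  [pred q | `[< exists2 x, x \in U & q = cls x >] ].

Lemma class_imageP U q : reflect (exists2 x, x \in U & q = cls x) (q \in class_image U).
Proof. exact: asboolP. Qed.

Lemma cls_image (U : {pred X}) x : x \in U -> cls x \in class_image U.
Proof. by move=> xU; apply/class_imageP; exists x. Qed.

Lemma class_image_submod U : submod_closed U -> submod_closed (class_image U).
Proof.
case=> U0 Ulin; split; first by rewrite -cls0 cls_image.
move=> c p p' /class_imageP[x xU ->] /class_imageP[x' x'U ->].
by rewrite -cls_linear cls_image ?Ulin.
Qed.

Lemma class_image_ract (U : {pred X}) :
  (forall x a, x \in U -> ract x a \in U) ->
  forall q a, q \in class_image U -> ract0 q a \in class_image U.
Proof. by move=> h q a /class_imageP[x xU ->]; rewrite ract0E cls_image ?h. Qed.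

Lemma climit_P1_P3 :
  axP1_P3 (A := deformed dA) ract ip -> axP1_P3 ract0 ip0.
Proof.
case=> I [XI [[sub dec orth] p2 p3]].
exists I, (fun i => class_image (XI i)).
have orth0 i j p q : i != j -> p \in class_image (XI i) -> q \in class_image (XI j) ->
    ip0 p q = 0.
  move=> ij /class_imageP[x xi ->] /class_imageP[y yj ->].
  by rewrite ip0E (orth _ _ _ _ ij xi yj) Defs.coef0.
(* Pairing with a vector of the summand [j] isolates the component [g j], since orthogonality
   removes all other terms. *)
have ip0_fsum (g : I -> CX) j p : finite_set [set i | g i <> 0]%classic ->
    (forall i, g i \in class_image (XI i)) -> p \in class_image (XI j) ->
    ip0 (\sum_(i \in [set: I]%classic) g i) p = ip0 (g j) p.
  move=> gfin gX pX.
  rewrite (fsum_morph (ip0_0l p) (fun q q' => ip0Dl q q' p) gfin).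
  rewrite (@fsbigTE _ _ _ _ [fset j]%fset) ?big_seq_fset1 // => i.
  by rewrite inE => ij; apply: orth0 (gX i) pX.
have decomposition q : exists g : I -> CX,
    [/\ forall i, g i \in class_image (XI i),
        finite_set [set i | g i <> 0]%classic
      & q = \sum_(i \in [set: I]%classic) g i].
  have [x ->] := cls_surj q; have [f [[fX ffin xE] _]] := dec x.
  exists (fun i => cls (f i)); split=> [i||]; first exact: cls_image.
    (* Passing to classes can only shrink the support. *)
    by apply: sub_finite_set ffin => i /= h fi; apply: h; rewrite fi cls0.
  by rewrite xE (fsum_morph cls0 clsD).
split; first split=> //.
- by move=> i; exact: class_image_submod.
- move=> q; have [f [fX ffin qE]] := decomposition q.
  exists f; split=> // g [gX gfin qE'].
  apply/funext => j; apply: ip0_nondegenerate => p.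
  (* The test vector [p] is arbitrary, but only its component [e j] pairs nontrivially with [f j]
     and [g j]. Against [e j], each of these two has the same pairing as the whole vector [q]. *)
  have [e [eX efin ->]] := decomposition p.
  rewrite climit_X2 [RHS]climit_X2 !(ip0_fsum _ j) //.
  by rewrite -!climit_X2 -(ip0_fsum _ j) // -qE qE' (ip0_fsum _ j).
- by move=> i q a; apply: class_image_ract => x b; exact: p2.
- move=> i; have [J [le [XJ [Omega [dir sJ mono un om]]]]] := p3 i.
  exists J, le, (fun s => class_image (XJ s)), (cls \o Omega); split=> //.
  + move=> s; have [sU sr] := sJ s.
    by split; [exact: class_image_submod | exact: class_image_ract].
  + move=> s t /mono st q /class_imageP[x xs ->]; exact/cls_image/st.
  + move=> q; split=> [/class_imageP[x /un[s xs] ->]|[s /class_imageP[x xs ->]]].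
      by exists s; apply: cls_image.
    by apply: cls_image; apply/un; exists s.
  + move=> s; have [os gen] := om s; split; first exact: cls_image.
    (* The series [a] acts on the class of [Omega s] through its zeroth order term, hence this
       witness. *)
    move=> q /class_imageP[x /gen[a ->] ->]; exists (a 0%N).
    by rewrite /= ract0E cls_ract_coef0.
Qed.

End Limit.

Theorem proposition9p4 (R : realDomainType) (A B : starAlg R)
    (dA : starDeformation A) (dB : starDeformation B)
    (X : lmodType (cplx (fps R)))
    (lact : fps B -> X -> X) (ract : X -> fps A -> X) (ip : X -> X -> fps A)
    (hX : bimodule (B := deformed dB) (A := deformed dA) lact ract)
    (h1 : axX1 (A := deformed dA) ip)
    (h2 : axX2 (A := deformed dA) ip)
    (h3 : axX3 (A := deformed dA) ract ip)
    (h5 : axX5 (B := deformed dB) (A := deformed dA) lact ip) :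
  let CX : lmodType (cplx R) := climit h1 h2 in
  let cls : X -> CX := climit_class h1 h2 in
  exists (lact0 : B -> CX -> CX) (ract0 : CX -> A -> CX) (ip0 : CX -> CX -> A),
    [/\ forall b x, lact0 b (cls x) = cls (lact (fpsC b) x),
        forall x a, ract0 (cls x) a = cls (ract x (fpsC a))
      & forall x y, ip0 (cls x) (cls y) = ip x y 0%N] /\
    [/\ bimodule lact0 ract0, axX1 ip0, axX2 ip0, axX3 ract0 ip0
      & axX5 lact0 ip0] /\
    [/\ axX4a (A := deformed dA) ip -> axX4a ip0,
        axtX6 dA ip -> axX6 ip0,
        axP1_P3 (A := deformed dA) ract ip -> axP1_P3 ract0 ip0
      & positive_deformation dA -> axX4 (A := deformed dA) ip -> axX4 ip0].
Proof.
move=> CX cls; exists (@lact0 _ _ _ _ _ lact _ h1 h2), (@ract0 _ _ _ _ ract _ h1 h2).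
exists (@ip0 _ _ _ _ _ h1 h2).
split; [split | split; split].
- exact: lact0E.
- exact: ract0E.
- exact: ip0E.
- exact: (climit_bimodule hX h1 h2 h3 h5).
- exact: climit_X1.
- exact: climit_X2.
- exact: climit_X3.
- exact: (climit_X5 hX h5).
- exact: climit_X4a.
- exact: climit_X6.
- exact: (climit_P1_P3 hX h1 h2 h3).
- exact: climit_X4.
Qed.
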